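(* Let $T^2=\mathbb R^2/\mathbb Z^2$, let $\sim$ be the equivalence relation on $T^2$ given by $p\sim -p$, let $S^2=T^2/{\sim}$ (a two-dimensional sphere) with projection $\pi\colon T^2\to S^2$, let $\tilde f\colon T^2\to T^2$ be $\tilde f(x,y)=(2x+y,x+y)$, and let $f\colon S^2\to S^2$ be the homeomorphism with $f(\pi(p))=\pi(\tilde f(p))$ for all $p\in T^2$. Then $f$ is cw2-expansive.
   Context: $S^2$ carries any metric compatible with its topology. A continuum is a compact connected set. A homeomorphism $f\colon X\to X$ of a compact metric space is cw2-expansive if there is $\delta>0$ such that whenever $A,B\subset X$ are continua with $\operatorname{diam}(f^n(A))\le\delta$ for all $n\ge0$ and $\operatorname{diam}(f^n(B))\le\delta$ for all $n\le 0$, the set $A\cap B$ has at most two points. *)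

(* Defs.v *)
From HB Require Import structures.
From mathcomp Require Import all_boot all_order all_algebra.
From mathcomp Require Import generic_quotient ring_quotient.
From mathcomp Require Import all_classical all_reals all_analysis.
From mathcomp Require Import ring.

Set Implicit Arguments.
Unset Strict Implicit.
Unset Printing Implicit Defensive.

Import Order.TTheory GRing.Theory Num.Theory.
Import numFieldNormedType.Exports.

Local Open Scope classical_set_scope.
Local Open Scope ring_scope.
Local Open Scope quotient_scope.

Section Expansivity.
Context {R : realType} {X : topologicalType}.

Record is_metric (d : X -> X -> R) : Prop := IsMetric {
  metric_eq0 : forall x y, d x y = 0 <-> x = y;
  metric_sym : forall x y, d x y = d y x;
  metric_triangle : forall x y z, d x z <= d x y + d y z }.

Definition compatible_metric (d : X -> X -> R) : Prop :=
  is_metric d /\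
  forall (x : X) (U : set X),
    nbhs x U <-> exists2 e : R, 0 < e & [set y | d x y < e] `<=` U.

(* Extended-real valued, so that an unbounded set has diameter +oo;
   the diameter of the empty set is -oo. *)
Definition diam (d : X -> X -> R) (A : set X) : \bar R :=
  ereal_sup [set (d xy.1 xy.2)%:E | xy in A `*` A].

Definition continuum (A : set X) : Prop := compact A /\ connected A.

Record homeo := Homeo {
  homeo_fun :> X -> X;
  homeo_inv : X -> X;
  homeo_funK : cancel homeo_fun homeo_inv;
  homeo_invK : cancel homeo_inv homeo_fun;
  homeo_fun_continuous : continuous homeo_fun;
  homeo_inv_continuous : continuous homeo_inv }.

Definition homeo_iter (f : homeo) (n : int) : X -> X :=
  match n with
  | Posz m => iter m f
  | Negz m => iter m.+1 (homeo_inv f)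
  end.

Definition cw2_expansive (d : X -> X -> R) (f : homeo) : Prop :=
  exists2 delta : R, 0 < delta &
    forall A B : set X, continuum A -> continuum B ->
      (forall n : int, 0 <= n ->
         (diam d (homeo_iter f n @` A) <= delta%:E)%E) ->
      (forall n : int, n <= 0 ->
         (diam d (homeo_iter f n @` B) <= delta%:E)%E) ->
      (A `&` B #<= `I_2)%card.

End Expansivity.
Arguments homeo X : clear implicits.

Section Torus.
Context (R : realType).

Definition int_lattice : {pred R * R} :=
  [pred v | (v.1 \is a Num.int) && (v.2 \is a Num.int)].

Lemma int_lattice_zmod_closed : zmod_closed int_lattice.
Proof.
split=> [|u v]; rewrite !inE ?rpred0 //=.
by move=> /andP[u1 u2] /andP[v1 v2]; rewrite !rpredB.
Qed.

HB.instance Definition _ :=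
  GRing.isZmodClosed.Build (R * R)%type int_lattice int_lattice_zmod_closed.

(* The quotient group R^2 / Z^2, with the quotient topology. *)
Definition torus : Type := quotient_topology (Quotient.quot int_lattice).

HB.instance Definition _ := Topological.on torus.
HB.instance Definition _ := Quotient.on torus.
HB.instance Definition _ := GRing.isZmodule.Build torus
  (@Quotient.addqA _ int_lattice) (@Quotient.addqC _ int_lattice)
  (@Quotient.add0q _ int_lattice) (@Quotient.addNq _ int_lattice).

Definition cat_lin (v : R * R) : R * R := (2 * v.1 + v.2, v.1 + v.2).

(* Independent of the representative chosen: see cat_mapE. *)
Definition cat_map (p : torus) : torus := \pi_torus (cat_lin (repr p)).

Lemma torus_eqP (u v : R * R) :
  reflect (\pi_torus u = \pi_torus v) (u - v \in int_lattice).
Proof.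
have -> := @Quotient.idealrBE _ int_lattice u v.
exact: (@eqP (Quotient.quot int_lattice)).
Qed.

Lemma torus_oppE (v : R * R) : - \pi_torus v = \pi_torus (- v).
Proof. by have := esym (@Quotient.pi_opp _ int_lattice v). Qed.

Lemma cat_lin_lattice (u v : R * R) :
  u - v \in int_lattice -> cat_lin u - cat_lin v \in int_lattice.
Proof.
move: u v => [a b] [x y] /andP[/= h1 h2]; apply/andP; split => /=.
  have -> : 2 * a + b - (2 * x + y) = (a - x) + (a - x) + (b - y) by ring.
  by apply: rpredD => //; apply: rpredD.
have -> : a + b - (x + y) = (a - x) + (b - y) by ring.
by apply: rpredD.
Qed.

Lemma cat_mapE (v : R * R) : cat_map (\pi_torus v) = \pi_torus (cat_lin v).
Proof. by apply/torus_eqP/cat_lin_lattice/torus_eqP; rewrite reprK. Qed.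

Definition opp_rel (p q : torus) : bool := (p == q) || (p == - q).

Lemma opp_rel_equiv : equiv_class_of opp_rel.
Proof.
split=> [p|p q|q p r]; rewrite /opp_rel ?eqxx //.
  by rewrite eq_sym -eqr_oppLR [- p == q]eq_sym.
by move=> /orP[]/eqP-> /orP[]/eqP->; rewrite ?opprK ?eqxx ?orbT.
Qed.
Canonical opp_rel_equivRel := EquivRelPack opp_rel_equiv.
Canonical opp_rel_encModRel := defaultEncModRel opp_rel.

Definition sphere : Type := quotient_topology {eq_quot opp_rel}.

HB.instance Definition _ := Topological.on sphere.
HB.instance Definition _ := Quotient.on sphere.

Lemma sphere_eqP (p q : torus) :
  reflect (\pi_sphere p = \pi_sphere q) ((p == q) || (p == - q)).
Proof. by apply: (iffP idP) => [h|]; [exact/eqmodP|move/eqmodP]. Qed.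

Lemma sphere_lift (g : R * R -> R * R) :
  continuous g -> {morph g : v / - v} ->
  (forall u v, u - v \in int_lattice -> g u - g v \in int_lattice) ->
  exists2 h : sphere -> sphere, continuous h &
    forall v, h (\pi_sphere (\pi_torus v)) = \pi_sphere (\pi_torus (g v)).
Proof.
move=> gc gN gL.
pose h (s : sphere) : sphere := \pi_sphere (\pi_torus (g (repr (repr s)))).
have hE v : h (\pi_sphere (\pi_torus v)) = \pi_sphere (\pi_torus (g v)).
  rewrite /h; have /sphere_eqP := reprK (\pi_sphere (\pi_torus v)).
  move: (repr (\pi_sphere _)) => q; rewrite -{1 2}[q]reprK torus_oppE => e.
  apply/sphere_eqP; move: e => /orP[] /eqP/torus_eqP/gL/torus_eqP e.
    by apply/orP; left; apply/eqP.
  by apply/orP; right; apply/eqP; rewrite torus_oppE -gN.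
exists h => //; apply/quotient_continuous/quotient_continuous.
have -> : (h \o \pi_sphere) \o \pi_torus = (\pi_sphere \o \pi_torus) \o g.
  by apply/funext => v /=; rewrite hE.
move=> v; apply: continuous_comp; first exact: gc.
by apply: continuous_comp; exact: pi_continuous.
Qed.

(* The homeomorphism of the sphere induced by cat_map exists (and it is unique,
   since \pi_sphere is onto). *)
Lemma sphere_homeo_exists : exists f : homeo sphere,
  forall p : torus, f (\pi_sphere p) = \pi_sphere (cat_map p).
Proof.
pose g (v : R * R) : R * R := (v.1 - v.2, 2 * v.2 - v.1).
have c1 : continuous (fst : R * R -> R) by move=> v; exact: cvg_fst.
have c2 : continuous (snd : R * R -> R) by move=> v; exact: cvg_snd.
have [|||f fc fE] := @sphere_lift cat_lin.
- move=> v.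
  apply: (@cvg_pair _ _ _ _ (nbhs (2 * v.1 + v.2)) (nbhs (v.1 + v.2))).
    by apply: cvgD; [apply: cvgM; [exact: cvg_cst|exact: c1]|exact: c2].
  by apply: cvgD; [exact: c1|exact: c2].
- by move=> [x y]; congr pair => /=; ring.
- exact: cat_lin_lattice.
have [|||k kc kE] := @sphere_lift g.
- move=> v.
  apply: (@cvg_pair _ _ _ _ (nbhs (v.1 - v.2)) (nbhs (2 * v.2 - v.1))).
    by apply: cvgB; [exact: c1|exact: c2].
  by apply: cvgB; [apply: cvgM; [exact: cvg_cst|exact: c2]|exact: c1].
- by move=> [x y]; congr pair => /=; ring.
- move=> [a b] [x y] /andP[/= h1 h2]; apply/andP; split => /=.
    have -> : a - b - (x - y) = (a - x) - (b - y) by ring.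
    by apply: rpredB.
  have -> : 2 * b - a - (2 * y - x) = (b - y) + (b - y) - (a - x) by ring.
  by apply: rpredB => //; apply: rpredD.
have gK v : g (cat_lin v) = v by case: v => x y; congr pair => /=; ring.
have Kg v : cat_lin (g v) = v by case: v => x y; congr pair => /=; ring.
have fK : cancel f k.
  by move=> s; rewrite -[s]reprK -[repr s]reprK fE kE gK.
have kK : cancel k f.
  by move=> s; rewrite -[s]reprK -[repr s]reprK kE fE Kg.
exists (Homeo fK kK fc kc) => p /=.
by rewrite -[p]reprK fE cat_mapE.
Qed.

End Torus.

(* Main.v *)
Require Import Defs.
From mathcomp Require Import all_boot all_order all_algebra.
From mathcomp Require Import generic_quotient.
From mathcomp Require Import all_classical all_reals all_analysis.
From mathcomp Require Import ring lra.

(* The plane covers the sphere by v |-> sproj v, the fibres being the classes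
   of v ~ +-v + m for m in the integer lattice, and cat_lin is diagonal in the
   coordinates (unstable, stable).  If all forward iterates of a connected set X
   are small, fix a lift p of a point of X.  At each time n the lifts of the
   points of the n-th iterate that are near the iterate of p are separated from
   the other lifts by an empty annulus.  Connectedness of X then provides every
   x in X with a lift q that stays close to p for times up to N, and since x has
   at most two lifts near p, one of them works for all N; so q - p is a short
   stable vector.  Connectedness is essential: without it an orbit may switch
   lifts near the four branch points.  Dually for backward iterates and unstable
   vectors.  Now let sproj p be in A and B.  A point of A and B has lifts q in
   the stable and r in the unstable line of p.  Either q - r is in the lattice,
   whence q = r = p, or q + r is; the second case yields at most one more point,
   because q + r is then determined, and q - p, r - p are its components. *)

Import Order.TTheory GRing.Theory Num.Theory.
Import numFieldNormedType.Exports.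

Local Open Scope ring_scope.
Local Open Scope quotient_scope.
Local Open Scope classical_set_scope.

(** Near a point of [X] the set [E] contains all of [X] or none of it, so [X] meets [E] in a
    relatively clopen nonempty set. *)
Lemma connected_locally_constant (T : topologicalType) (X E : set T) (a : T) :
  connected X -> X a -> E a ->
  (forall x, X x -> \forall y \near x, X y -> (E x <-> E y)) ->
  X `<=` E.
Proof.
move=> cX Xa Ea h; suff <- : X `&` E = X by exact: subIsetr.
apply: cX; first by exists a.
- exists (interior [set y | X y -> E y]); first exact: open_interior.
  apply/seteqP; split=> x [Xx] => [Ex|/interior_subset /(_ Xx) Ex]; split=> //.
  by apply: filterS (h x Xx) => y hy Xy; apply/(hy Xy).
- exists (~` interior [set y | X y -> ~ E y]).
    by apply: open_closedC; exact: open_interior.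
  apply/seteqP; split=> x [Xx] => [Ex|nEx]; split=> //.
    by move=> /interior_subset/(_ Xx).
  apply: contrapT => Ex; apply: nEx.
  by apply: filterS (h x Xx) => y hy Xy; apply: contra_not Ex => /(hy Xy).
Qed.

(** * Eigen-coordinates on the plane and the adapted norm *)

Section Plane.
Context {R : realType}.
Implicit Types (u v w p q : R * R) (x y : sphere R).

Definition golden : R := (1 + Num.sqrt 5) / 2.

Lemma golden_sqr : golden * golden = golden + 1.
Proof.
have := @sqr_sqrtr R 5 (ler0n _ _); rewrite expr2 /golden => h.
by field: h.
Qed.

Lemma golden_bounds : 3 / 2 < golden < 2.
Proof.
have g0 : 0 < golden by rewrite /golden; have := sqrtr_ge0 (5 : R); lra.
have := golden_sqr; nra.
Qed.

(** Left eigenvectors of the matrix of [cat_lin], with eigenvalues [golden + 1] and [2 - golden].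
    The kernel of [unstable] is thus the stable line, and that of [stable] the unstable one. *)
Definition unstable v : R := golden * v.1 + v.2.
Definition stable v : R := (1 - golden) * v.1 + v.2.

Definition nrm v : R := Num.max `|unstable v| `|stable v|.

Lemma unstableB u v : unstable (u - v) = unstable u - unstable v.
Proof. by rewrite /unstable /=; ring. Qed.

Lemma stableB u v : stable (u - v) = stable u - stable v.
Proof. by rewrite /stable /=; ring. Qed.

Lemma unstableN v : unstable (- v) = - unstable v.
Proof. by rewrite /unstable /=; ring. Qed.

Lemma stableN v : stable (- v) = - stable v.
Proof. by rewrite /stable /=; ring. Qed.

Lemma unstable_le v : `|unstable v| <= nrm v.
Proof. by rewrite /nrm le_max lexx. Qed.

Lemma stable_le v : `|stable v| <= nrm v.
Proof. by rewrite /nrm le_max lexx orbT. Qed.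

Lemma nrmN v : nrm (- v) = nrm v.
Proof. by rewrite /nrm unstableN stableN !normrN. Qed.

Lemma nrm_subC u v : nrm (u - v) = nrm (v - u).
Proof. by rewrite -nrmN opprB. Qed.

Lemma nrm0 : nrm 0 = 0.
Proof. by rewrite /nrm /unstable /stable /= !mulr0 !addr0 normr0 maxxx. Qed.

Lemma ler_nrmB u v : nrm (u - v) <= nrm u + nrm v.
Proof.
rewrite {1}/nrm ge_max unstableB stableB.
by rewrite !(le_trans (ler_normB _ _)) ?lerD ?unstable_le ?stable_le.
Qed.

Lemma ler_nrmD u v : nrm (u + v) <= nrm u + nrm v.
Proof. by rewrite -{1}[v]opprK -(nrmN v) ler_nrmB. Qed.

Lemma ler_nrm_triangle v u w : nrm (u - w) <= nrm (u - v) + nrm (v - w).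
Proof. by rewrite -{1}(subrKA v) ler_nrmD. Qed.

Lemma eigen_coords_inj v : unstable v = 0 -> stable v = 0 -> v = 0.
Proof.
case: v => a b; rewrite /unstable /stable /= => hu hs.
have /andP[g1 g2] := golden_bounds.
have : (2 * golden - 1) * a = 0 by rewrite -[RHS](subrr 0) -{1}hu -hs; ring.
move/eqP; rewrite mulf_eq0 => /orP[/eqP ?|/eqP a0]; first by exfalso; lra.
by congr pair => //; move: hu; rewrite a0 mulr0 add0r.
Qed.

Lemma int_norm_lt1 (a : R) : a \is a Num.int -> `|a| < 1 -> a = 0.
Proof.
move=> /intrP[m ->]; rewrite -intr_norm ltrz1 => h.
by apply/eqP; rewrite intr_eq0; move: h; case: m => [[]|].
Qed.

(* The first coordinate is recovered from unstable v - stable v, whose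
   coefficient 2 * golden - 1 exceeds 2. *)
Lemma lattice_nrm_lt1 v : v \in @int_lattice R -> nrm v < 1 -> v = 0.
Proof.
case: v => a b /andP[/= ia ib] h.
have := le_lt_trans (unstable_le _) h; have := le_lt_trans (stable_le _) h.
have /andP[g1 g2] := golden_bounds.
rewrite /unstable /stable /= !ltr_norml => hs hu.
have a0 : a = 0 by apply: int_norm_lt1 => //; rewrite ltr_norml; nra.
have b0 : b = 0 by apply: int_norm_lt1 => //; rewrite ltr_norml; move: hu; rewrite a0; lra.
by rewrite a0 b0.
Qed.

(** * The branched covering of the sphere by the plane *)

Definition sproj v : sphere R := \pi_(sphere R) (\pi_(torus R) v).

Lemma sprojP u v :
  sproj u = sproj v <->
  u - v \in @int_lattice R \/ u + v \in @int_lattice R.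
Proof.
split=> [/sphere_eqP/orP[]/eqP|h].
- by move/torus_eqP; left.
- by rewrite torus_oppE => /torus_eqP; rewrite opprK; right.
apply/sphere_eqP/orP; rewrite torus_oppE.
by case: h => h; [left|right]; apply/eqP/torus_eqP; rewrite ?opprK.
Qed.

Lemma sproj_surj x : exists v, x = sproj v.
Proof. by exists (repr (repr x)); rewrite /sproj !reprK. Qed.

Lemma sproj_cont : continuous sproj.
Proof. by move=> v; apply: continuous_comp; exact: pi_continuous. Qed.

(* Deck transformations of sproj are isometries for nrm, so they carry a
   pair of lifts to a pair of lifts at the same distance. *)
Lemma lift_transport u u' v : sproj u' = sproj u ->
  exists2 v', sproj v' = sproj v & v' - u' = v - u \/ v' - u' = - (v - u).
Proof.
move=> /sprojP[] h.
  exists (v + (u' - u)); last by left; rewrite addrA addrAC addrK.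
  by apply/sprojP; left; rewrite addrAC subrr add0r.
exists (- v + (u' + u)); last first.
  by right; rewrite addrA addrAC addrK opprB addrC.
by apply/sprojP; right; rewrite addrAC addNr add0r.
Qed.

Lemma lift_transport_nrm u u' v : sproj u' = sproj u ->
  exists2 v', sproj v' = sproj v & nrm (v' - u') = nrm (v - u).
Proof.
by move=> /(lift_transport _ _ v)[v' hv [] e]; exists v'; rewrite // e ?nrmN.
Qed.

Lemma sproj_nrm_inj u v : u - v \in @int_lattice R -> nrm (u - v) < 1 -> u = v.
Proof. by move=> h /(lattice_nrm_lt1 _ h)/subr0_eq. Qed.

(** Pigeonhole on the two kinds of lifts, [u + m] and [- u + m]: two lifts of the same kind differ
    by a lattice vector, and a short one vanishes. *)
Lemma three_lifts u v w : sproj v = sproj u -> sproj w = sproj u ->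
  nrm (v - u) < 1 -> nrm (w - u) < 1 -> nrm (w - v) < 1 ->
  v = u \/ w = u \/ w = v.
Proof.
move=> /sprojP[vu _ n1 _ _|vu /sprojP[wu _ n1 _|wu _ _ n1]].
- by left; apply: sproj_nrm_inj.
- by right; left; apply: sproj_nrm_inj.
right; right; apply: sproj_nrm_inj => //.
by have := rpredB wu vu; rewrite opprD addrACA subrr addr0.
Qed.

Lemma nrm_nbhs v (e : R) : 0 < e -> \forall w \near v, nrm (w - v) < e.
Proof.
move=> e0.
have cf : {for v, continuous (fst : R * R -> R)} by exact: cvg_fst.
have cs : {for v, continuous (snd : R * R -> R)} by exact: cvg_snd.
have e40 : 0 < e / 4 by rewrite divr_gt0.
have /andP[g1 g2] := golden_bounds.
have n1 : \forall w \near v, `|v.1 - w.1| < e / 4.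
  by have /cvgrPdist_lt/(_ _ e40) := cf.
have n2 : \forall w \near v, `|v.2 - w.2| < e / 4.
  by have /cvgrPdist_lt/(_ _ e40) := cs.
near=> w.
have : `|v.1 - w.1| < e / 4 by near: w.
have : `|v.2 - w.2| < e / 4 by near: w.
rewrite /nrm gt_max /unstable /stable /= !ltr_norml => /andP[? ?] /andP[? ?].
apply/andP; split; apply/andP; split; nra.
Unshelve. all: by end_near. Qed.

Lemma sproj_ball_open a (e : R) :
  open [set x | exists2 v, sproj v = x & nrm (v - a) < e].
Proof.
(* By definition of both quotient topologies, openness is that of the preimage in the plane. *)
set U := [set x | _]; change (open (sproj @^-1` U)).
rewrite openE => v [w hw we]; rewrite /interior.
have e0 : 0 < e - nrm (w - a) by rewrite subr_gt0.
near=> v'.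
have [w' hw' ww'] := lift_transport_nrm _ _ v' hw.
exists w' => //; apply: le_lt_trans (ler_nrm_triangle w _ _) _; rewrite ww' -ltrBrDr.
by near: v'; exact: nrm_nbhs.
Unshelve. all: by end_near. Qed.

Lemma sphere_compact : compact [set: sphere R].
Proof.
have -> : [set: sphere R] = sproj @` (`[0, 1] `*` `[0, 1]).
  apply/seteqP; split=> // x _; have [[a b] ->] := sproj_surj x.
  have frac (r : R) : 0 <= r - (Num.floor r)%:~R <= 1.
    have := floor_itv r; rewrite intrD => /andP[]; lra.
  exists (a - (Num.floor a)%:~R, b - (Num.floor b)%:~R).
    by split; rewrite /= in_itv /= frac.
  by apply/sprojP; left; apply/andP; split; rewrite /= addrAC subrr add0r rpredN intr_int.
apply: continuous_compact; first exact/continuous_subspaceT/sproj_cont.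
by apply: compact_setX; exact: segment_compact.
Qed.

(** * Lifting closeness on the sphere to the plane *)

Section Metric.
Context {d : sphere R -> sphere R -> R} (hd : compatible_metric d).

(* Lebesgue number of the cover of the sphere by projected balls. *)
Lemma metric_close_lifts (eta : R) : 0 < eta ->
  exists2 delta : R, 0 < delta & forall p q, d (sproj p) (sproj q) <= delta ->
    exists2 p', sproj p' = sproj p & nrm (q - p') < eta.
Proof.
move=> eta0; have [[_ dC dT] hn] := hd.
pose P (e : R) x := forall y, d x y <= e ->
  exists v w, [/\ sproj v = x, sproj w = y & nrm (w - v) < eta].
(* With the filter of small positive radii, compactness turns a radius valid near each point into a
   uniform one. *)
have /compact_near_coveringP/(_ R 0^'+ P _) := sphere_compact.
case.
- move=> x _; have [a ->] := sproj_surj x.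
  pose U := [set x | exists2 v, sproj v = x & nrm (v - a) < eta / 2].
  have /hn[e e0 eU] : nbhs (sproj a) U.
    apply: open_nbhs_nbhs; split; first exact: sproj_ball_open.
    by exists a => //; rewrite subrr nrm0 divr_gt0.
  exists ([set y | d (sproj a) y < e / 2], [set r | r < e / 2]).
    split=> /=; last by apply: nbhs_right_lt; rewrite divr_gt0.
    by apply/hn; exists (e / 2) => //; rewrite divr_gt0.
  move=> [y r] [/= ya re] z yz.
  have [v hv va] : U y by apply: eU => /=; lra.
  have [w hw wa] : U z by apply: eU => /=; have := dT (sproj a) y z; lra.
  exists v, w; split => //; apply: le_lt_trans (ler_nrm_triangle a _ _) _.
  rewrite (nrm_subC a); lra.
move=> e e0 he; exists (e / 2); first by rewrite divr_gt0.
move=> p q pq.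
have e20 : 0 < e / 2 by rewrite divr_gt0.
have e2 : ball_ Num.norm 0 e (e / 2).
  by rewrite /ball_ /= sub0r normrN gtr0_norm //; lra.
have [v [w [hv hw vw]]] := he (e / 2) e2 e20 (sproj p) Logic.I (sproj q) pq.
(* A deck transformation moves [w] to the prescribed lift [q]. *)
have [p' hp' e'] := lift_transport_nrm _ _ v (esym hw).
by exists p'; [rewrite hp' hv|rewrite nrm_subC e' nrm_subC].
Qed.

(** * Following an orbit by lifts *)

Section Tracking.
Context {eta : R} (eta_gt0 : 0 < eta) (eta_small : 40 * eta < 1).

(* The lifts near those of sproj p that lie near p form one cluster around p,
   or two when p is close to a fixed point of a deck transformation -v + m
   (a branch point of sproj); either way an empty annulus surrounds them. *)
Lemma annulus_gap p : exists c : R, 0 <= c <= 4 * eta /\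
  forall q p', sproj p' = sproj p -> nrm (q - p') < eta ->
    nrm (q - p) < c + eta -> nrm (q - p) <= c.
Proof.
have e0 := eta_gt0; have e1 := eta_small.
have same p1 q r : r - p1 \in @int_lattice R -> nrm (q - r) < eta ->
    nrm (q - p1) < 10 * eta -> r = p1.
  move=> h1 h2 h3; apply: sproj_nrm_inj => //.
  by apply: le_lt_trans (ler_nrm_triangle q _ _) _; rewrite (nrm_subC r); lra.
(* If [p] has a lift [p2] of the opposite kind within [3 * eta], the points [eta]-close to [p] or
   [p2] lie within [4 * eta] of [p]. Otherwise a point within [2 * eta] of [p] cannot be [eta]-close
   to a lift of that kind. *)
have [[p2 p2L np2]|far] := pselect
    (exists2 p2, p2 + p \in @int_lattice R & nrm (p2 - p) < 3 * eta).
- exists (4 * eta); split; first by apply/andP; split; lra.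
  move=> q p' /sprojP[hp'|hp'] qp' qp.
    by rewrite -(same _ _ _ hp' qp') ?ltW //; lra.
  have tri := ler_nrm_triangle p2 q p.
  suff p'E : p' = p2 by rewrite p'E in qp'; lra.
  apply: (same _ q) => //; first by have := rpredB hp' p2L; rewrite opprD addrACA subrr addr0.
  by have := ler_nrm_triangle p q p2; rewrite (nrm_subC p); lra.
- exists eta; split; first by apply/andP; split; lra.
  move=> q p' /sprojP[hp'|hp'] qp' qp.
    by rewrite -(same _ _ _ hp' qp') ?ltW //; lra.
  exfalso; apply: far; exists p' => //.
  by have := ler_nrm_triangle q p' p; rewrite (nrm_subC p' q); lra.
Qed.

Context {delta : R} (close_lifts : forall p q, d (sproj p) (sproj q) <= delta ->
    exists2 p', sproj p' = sproj p & nrm (q - p') < eta).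
Context {g : sphere R -> sphere R} {G : R * R -> R * R}.
Context (gG : forall v, g (sproj v) = sproj (G v)).
Context (GB : {morph G : u v / u - v}) (G3 : forall v, nrm (G v) <= 3 * nrm v).
Context {X : set (sphere R)} (X_connected : connected X).
Context (X_small : forall n x y, X x -> X y -> d (iter n g x) (iter n g y) <= delta).
Context {p : R * R} (Xp : X (sproj p)).

Lemma iter_sproj n v : iter n g (sproj v) = sproj (iter n G v).
Proof. by elim: n => //= n ->; rewrite gG. Qed.

Lemma iter_morphB n : {morph iter n G : u v / u - v}.
Proof. by elim: n => [|n IH] u v; rewrite ?iterS ?IH ?GB. Qed.

Lemma iter_nrm_le n v : nrm (iter n G v) <= 3 ^+ n * nrm v.
Proof.
elim: n => [|n IH] /=; first by rewrite expr0 mul1r.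
by apply: le_trans (G3 _) _; rewrite exprS -mulrA ler_pM2l.
Qed.

Lemma iter_nrmN n v : nrm (iter n G (- v)) = nrm (iter n G v).
Proof.
have G0 : iter n G 0 = 0 by rewrite -{1}(subrr 0) iter_morphB subrr.
by rewrite -sub0r iter_morphB G0 sub0r nrmN.
Qed.

Lemma finite_tracking N x : X x ->
  exists2 q, sproj q = x & forall n, (n <= N)%N -> nrm (iter n G (q - p)) <= 4 * eta.
Proof.
have e0 := eta_gt0.
have [c hc] := choice (fun n => annulus_gap (iter n G p)).
(* A displacement below [r] stays below [eta] up to time [N], as [G] expands at most by 3. *)
pose r : R := eta / 3 ^+ N.
have r0 : 0 < r by rewrite divr_gt0 // exprn_gt0.
pose E := [set x | exists2 q, sproj q = x &
  forall n, (n <= N)%N -> nrm (iter n G (q - p)) < c n + eta].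
(* For points of [X] the empty annulus improves the outer bound [c n + eta] to the inner bound
   [c n]. *)
have EX q : X (sproj q) ->
    (forall n, (n <= N)%N -> nrm (iter n G (q - p)) < c n + eta) ->
    forall n, (n <= N)%N -> nrm (iter n G (q - p)) <= c n.
  move=> Xq hq n nN; have [_ gap] := hc n.
  have := X_small n _ _ Xp Xq; rewrite !iter_sproj => /close_lifts[p' hp' qp'].
  by rewrite iter_morphB; apply: (gap _ p') => //; rewrite -iter_morphB hq.
(* The slack [eta] gained by [EX] absorbs the displacement from [a] to [b]. *)
have step a b : nrm (b - a) < r -> X (sproj a) -> E (sproj a) -> E (sproj b).
  move=> ba Xa [a' aa' ha].
  have [b' hb' bb'] := lift_transport _ _ b aa'.
  exists b' => // n nN; rewrite -(subrKA a').
  have -> : b' - a' + (a' - p) = (b' - a') - (p - a') by rewrite opprB.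
  rewrite iter_morphB; apply: le_lt_trans (ler_nrmB _ _) _.
  rewrite -(opprB a' p) iter_nrmN addrC.
  apply: ler_ltD; first by apply: EX; rewrite ?aa'.
  have -> : nrm (iter n G (b' - a')) = nrm (iter n G (b - a)).
    by case: bb' => ->; rewrite ?iter_nrmN.
  apply: le_lt_trans (iter_nrm_le _ _) _.
  have : 3 ^+ N * nrm (b - a) < eta by rewrite mulrC -ltr_pdivlMr ?exprn_gt0.
  apply: le_lt_trans; rewrite ler_wpM2r ?(le_trans (normr_ge0 _) (unstable_le _)) //.
  by rewrite ler_weXn2l // ler1n.
have : X `<=` E.
  apply: connected_locally_constant X_connected Xp _ _.
    exists p => // n nN; have [/andP[c0 _] _] := hc n.
    by rewrite iter_morphB subrr nrm0; lra.
  move=> y Xy; have [a ya] := sproj_surj y; rewrite ya in Xy *.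
  have : nbhs (sproj a) [set x | exists2 v, sproj v = x & nrm (v - a) < r].
    apply: open_nbhs_nbhs; split; first exact: sproj_ball_open.
    by exists a => //; rewrite subrr nrm0.
  apply: filterS => z [b <- ba] Xb.
  by split; apply: step => //; rewrite nrm_subC.
move=> + Xx => /(_ x Xx)[q qx hq]; exists q => // n nN.
have [/andP[_ c4] _] := hc n.
by apply: le_trans c4; apply: (EX q) => //; rewrite qx.
Qed.

(** Were every lift to escape, [q1] would be chosen to outlast the escape of [q0], and [q2] those of
    both: three distinct lifts near [p], against [three_lifts]. *)
Lemma tracking x : X x ->
  exists2 q, sproj q = x & forall n, nrm (iter n G (q - p)) <= 4 * eta.
Proof.
move=> Xx; apply: contrapT => none; have e1 := eta_small.
have escape q : sproj q = x -> exists n, 4 * eta < nrm (iter n G (q - p)).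
  move=> qx; apply: contrapT => h; apply: none; exists q => // n.
  by rewrite leNgt; apply/negP => hn; apply: h; exists n.
have [q0 q0x h0] := finite_tracking 0 _ Xx.
have [n1 hn1] := escape _ q0x.
have [q1 q1x h1] := finite_tracking n1 _ Xx.
have [n2 hn2] := escape _ q1x.
have [q2 q2x h2] := finite_tracking (maxn n1 n2) _ Xx.
have near q q' : nrm (q - p) <= 4 * eta -> nrm (q' - p) <= 4 * eta -> nrm (q' - q) < 1.
  by move=> ? ?; have := ler_nrm_triangle p q' q; rewrite (nrm_subC p); lra.
have := h0 0%N isT; have := h1 0%N isT; have := h2 0%N isT => /= k2 k1 k0.
have [e|[e|e]] : q1 = q0 \/ q2 = q0 \/ q2 = q1.
  by apply: three_lifts; rewrite ?q0x ?near.
- by have := h1 n1 (leqnn _); rewrite e leNgt hn1.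
- by have := h2 n1 (leq_maxl _ _); rewrite e leNgt hn1.
- by have := h2 n2 (leq_maxr _ _); rewrite e leNgt hn2.
Qed.

End Tracking.

Lemma diam_le (A : set (sphere R)) (delta : R) x y :
  (diam d A <= delta%:E)%E -> A x -> A y -> d x y <= delta.
Proof.
move=> dA Ax Ay; rewrite -lee_fin; apply: le_trans dA.
by apply: ereal_sup_ubound; exists (x, y).
Qed.

End Metric.

(** * The cat map and its inverse in eigen-coordinates *)

Definition cat_inv v : R * R := (v.1 - v.2, 2 * v.2 - v.1).

Lemma cat_invK v : cat_lin (cat_inv v) = v.
Proof. by case: v => a b; congr pair => /=; ring. Qed.

Lemma cat_linB : {morph @cat_lin R : u v / u - v}.
Proof. by move=> [a b] [a' b']; congr pair => /=; ring. Qed.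

Lemma cat_invB : {morph cat_inv : u v / u - v}.
Proof. by move=> [a b] [a' b']; congr pair => /=; ring. Qed.

Lemma unstable_cat_lin v : unstable (cat_lin v) = (golden + 1) * unstable v.
Proof. by have h := golden_sqr; rewrite /unstable /=; ring: h. Qed.

Lemma stable_cat_lin v : stable (cat_lin v) = (2 - golden) * stable v.
Proof. by have h := golden_sqr; rewrite /stable /=; ring: h. Qed.

Lemma unstable_cat_inv v : unstable (cat_inv v) = (2 - golden) * unstable v.
Proof. by have h := golden_sqr; rewrite /unstable /=; ring: h. Qed.

Lemma stable_cat_inv v : stable (cat_inv v) = (golden + 1) * stable v.
Proof. by have h := golden_sqr; rewrite /stable /=; ring: h. Qed.

Lemma nrm_le_of_eigen (a b : R) u v : `|a| <= 3 -> `|b| <= 3 ->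
  unstable u = a * unstable v -> stable u = b * stable v -> nrm u <= 3 * nrm v.
Proof.
move=> a3 b3 hu hs; rewrite {1}/nrm hu hs !normrM ge_max.
by rewrite !ler_pM ?unstable_le ?stable_le.
Qed.

Lemma nrm_cat_lin v : nrm (cat_lin v) <= 3 * nrm v.
Proof.
have /andP[g1 g2] := golden_bounds.
apply: nrm_le_of_eigen (unstable_cat_lin v) (stable_cat_lin v);
  by rewrite ler_norml; lra.
Qed.

Lemma nrm_cat_inv v : nrm (cat_inv v) <= 3 * nrm v.
Proof.
have /andP[g1 g2] := golden_bounds.
apply: nrm_le_of_eigen (unstable_cat_inv v) (stable_cat_inv v);
  by rewrite ler_norml; lra.
Qed.

(** A nonzero value would grow at least like [2 ^+ n]. This puts tracked differences on the stable
    line for [cat_lin], on the unstable line for [cat_inv]. *)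
Lemma expanding_bounded_eq0 (l : R * R -> R) (G : R * R -> R * R) (a C : R) v :
  2 <= a -> (forall w, l (G w) = a * l w) ->
  (forall n, `|l (iter n G v)| <= C) -> l v = 0.
Proof.
move=> a2 lG bnd; apply/eqP; apply: contrapT => /negP; rewrite -normr_gt0 => lv0.
have lE n : l (iter n G v) = a ^+ n * l v.
  by elim: n => [|n IH]; rewrite ?expr0 ?mul1r // iterS lG IH exprS mulrA.
have a0 : 0 <= a by lra.
have C0 : 0 <= C / `|l v| by rewrite divr_ge0 // (le_trans _ (bnd 0%N)).
set n := Num.bound (C / `|l v|).
have : C / `|l v| < n%:R by exact: archi_boundP.
apply/negP; rewrite -leNgt ler_pdivlMr //; apply: le_trans (bnd n).
rewrite lE normrM ler_wpM2r // normrX ger0_norm //.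
apply: (@le_trans _ _ (2 ^+ n)); last by rewrite lerXn2r ?nnegrE.
by rewrite -natrX ler_nat ltnW // ltn_expl.
Qed.

End Plane.

Theorem proposition2p2p1 (R : realType)
    (d : sphere R -> sphere R -> R) (hd : compatible_metric d)
    (f : homeo (sphere R))
    (hf : forall p : torus R,
        f (\pi_(sphere R) p) = \pi_(sphere R) (cat_map p)) :
  cw2_expansive d f.
Proof.
pose eta : R := 1 / 50.
have eta0 : 0 < eta by rewrite /eta; lra.
have eta1 : 40 * eta < 1 by rewrite /eta; lra.
have [delta delta0 close] := metric_close_lifts hd _ eta0.
have fE v : f (sproj v) = sproj (cat_lin v) by rewrite /sproj hf cat_mapE.
have fiE v : homeo_inv f (sproj v) = sproj (cat_inv v).
  by rewrite -{1}(cat_invK v) -fE homeo_funK.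
have /andP[g1 g2] := @golden_bounds R.
exists delta => // A B [_ cA] [_ cB] hA hB.
have sA n x y : A x -> A y -> d (iter n f x) (iter n f y) <= delta.
  by move=> Ax Ay; apply: diam_le (hA (Posz n) isT) _ _; [exists x|exists y].
have sB n x y : B x -> B y ->
    d (iter n (homeo_inv f) x) (iter n (homeo_inv f) y) <= delta.
  have hn : (diam d (iter n (homeo_inv f) @` B) <= delta%:E)%E.
    (* [Negz n] stands for [n.+1] backward steps, so time 0 comes from the [Posz] branch. *)
    by case: n => [|n]; [exact: (hB 0 isT)|exact: (hB (Negz n) isT)].
  by move=> Bx By; apply: diam_le hn _ _; [exists x|exists y].
have [AB0|/set0P[x0 [Ax0 Bx0]]] := eqVneq (A `&` B) set0.
  by rewrite AB0; exact: card_ge0.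
have [p x0E] := sproj_surj x0; rewrite x0E in Ax0 Bx0.
have sep x : (A `&` B) x -> x <> x0 ->
    exists q r, [/\ sproj q = x, sproj r = x, q + r \in @int_lattice R,
      unstable (q - p) = 0 /\ nrm (q - p) <= 4 * eta &
      stable (r - p) = 0 /\ nrm (r - p) <= 4 * eta].
  move=> [Ax Bx] xx0.
  have [q qx hq] := tracking eta0 eta1 close fE cat_linB nrm_cat_lin cA sA Ax0 x Ax.
  have [r rx hr] := tracking eta0 eta1 close fiE cat_invB nrm_cat_inv cB sB Bx0 x Bx.
  have q0 : unstable (q - p) = 0.
    apply: (@expanding_bounded_eq0 _ _ _ (golden + 1)) unstable_cat_lin _; first lra.
    by move=> n; exact: le_trans (unstable_le _) (hq n).
  have r0 : stable (r - p) = 0.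
    apply: (@expanding_bounded_eq0 _ _ _ (golden + 1)) stable_cat_inv _; first lra.
    by move=> n; exact: le_trans (stable_le _) (hr n).
  have := hq 0%N; have := hr 0%N => /= nr nq.
  exists q, r; split=> //.
  (* If [q - r] is in the lattice, its norm, at most [8 * eta], forces [q = r]; then both
     coordinates of [q - p] vanish and [x = x0]. *)
  have /sprojP[qr|//] : sproj q = sproj r by rewrite qx rx.
  case: xx0; rewrite -qx x0E; congr sproj.
  have qrE : q = r.
    apply: sproj_nrm_inj => //.
    by have := ler_nrm_triangle p q r; rewrite (nrm_subC p); lra.
  by apply/subr0_eq/eigen_coords_inj => //; rewrite qrE.
have uniq x x' : (A `&` B) x -> (A `&` B) x' -> x <> x0 -> x' <> x0 -> x = x'.
  move=> ABx ABx' /(sep _ ABx)[q [r [_ <- L [uq nq] [sr nr]]]].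
  move=> /(sep _ ABx')[q' [r' [_ <- L' [uq' nq'] [sr' nr']]]].
  (* The difference of the two sums is a lattice vector of norm at most [16 * eta], hence zero. So
     [r - r'] lies on both eigenlines. *)
  have e : q + r = q' + r'.
    apply: sproj_nrm_inj; first exact: rpredB.
    have -> : q + r - (q' + r') = (q - q') + (r - r') by rewrite opprD addrACA.
    have := ler_nrm_triangle p q q'; have := ler_nrm_triangle p r r'.
    rewrite (nrm_subC p q') (nrm_subC p r').
    by have := ler_nrmD (q - q') (r - r'); lra.
  congr sproj; apply/subr0_eq/eigen_coords_inj.
    have -> : r - r' = (q' - p) - (q - p).
      by apply/eqP; rewrite opprB subrKA subr_eq addrAC -e addrC addKr.
    by rewrite unstableB uq uq' subrr.
  have -> : r - r' = (r - p) - (r' - p) by rewrite opprB subrKA.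
  by rewrite stableB sr sr' subrr.
have [[x1 [ABx1 x10]]|none] := pselect (exists x, (A `&` B) x /\ x <> x0).
  apply: card_le_trans (card_image_le (fun n => if n == 0 then x0 else x1) _).
  apply: subset_card_le => x ABx.
  have [->|/eqP xx0] := eqVneq x x0; first by exists 0.
  by exists 1 => //=; apply: uniq.
apply: card_le_trans (card_image_le (fun=> x0) _).
apply: subset_card_le => x ABx; exists 0 => //.
by apply: contrapT => e; apply: none; exists x; split=> // /esym.
Qed.
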